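(* Let $c$ be an initial conformation of solitaire Clobber on the line. It is possible to reduce $c$ to $k$ pawns (i.e. there is a game on $c$ after which exactly $k$ pawns remain) if and only if there exists a word $w\in\Sigma^{|c|-1}$ such that (i) for each $i$, $w_i\in\{\overrightarrow s,\overleftarrow s,\overline s\}$ if $c_i=c_{i+1}$, and $w_i\in\{\overrightarrow a,\overleftarrow a,\overline a\}$ otherwise; (ii) $\overline x w\overline x$ contains none of the forbidden patterns (1)-(7) as a factor (block of consecutive letters); (iii) $w$ contains exactly $k-1$ occurrences of $\overline x$ (i.e. exactly $k-1$ letters in $\{\overline a,\overline s\}$). Moreover, a sequence of moves reducing $c$ to $k$ pawns can then be deduced in linear time from $w$. Here the forbidden patterns are: (1) $\overleftarrow x\,\overrightarrow x$; (2) $\overrightarrow s\,\overleftarrow s$; (3) $\overline x\,\overrightarrow s$ and $\overleftarrow s\,\overline x$; (4) $\overrightarrow x\,\overrightarrow a\,\overrightarrow x$, $\overrightarrow x\,\overrightarrow a\,\overline x$, $\overleftarrow x\,\overleftarrow a\,\overleftarrow x$ and $\overline x\,\overleftarrow a\,\overleftarrow x$; (5) $\overline x\,\overrightarrow a\,\overleftarrow s$ and $\overrightarrow s\,\overleftarrow a\,\overline x$; (6) $\overrightarrow x\,\overrightarrow a\,\overleftarrow a\,\overleftarrow x$; (7) $\overline x\,\overrightarrow a\,\overleftarrow a\,\overline x$.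
   Context: Solitaire Clobber on the line: an initial conformation is a nonempty word $c=c_1\cdots c_n$, $c_i\in\{\bullet,\circ\}$, of length $n=|c|$; a pawn of color $c_i$ (black or white) is placed on position $i$, for $i=1,\dots,n$, and positions $i,i+1$ are adjacent. A legal move consists in moving a pawn from its position onto an adjacent position occupied by a pawn of the opposite color; that latter pawn is removed (taken), and the position left becomes empty. The single player may move a pawn of either color at each turn. A game on $c$ is any finite (possibly empty) sequence of legal moves starting from $c$. Alphabet: $\Sigma=\{\overline a,\overline s,\overrightarrow a,\overrightarrow s,\overleftarrow a,\overleftarrow s\}$. The symbol $x$ is a ''don't care'' base letter: each occurrence of $x$ in a pattern stands, independently of the others, for $a$ or $s$ (so $\overrightarrow x$ means $\overrightarrow a$ or $\overrightarrow s$, $\overline x$ means $\overline a$ or $\overline s$, etc.). In $\overline x w\overline x$, the first and last letters are barred letters; whether they are $\overline a$ or $\overline s$ is irrelevant, since the patterns never distinguish the two. *)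

(* Defs.v *)
From HB Require Import structures.
From mathcomp Require Import all_boot.

Set Implicit Arguments.
Unset Strict Implicit.
Unset Printing Implicit Defensive.

(** * Solitaire Clobber on the line

    Positions are numbered from 0. *)

Inductive color := Black | White.

Definition color_code (x : color) : bool := if x is Black then true else false.
Definition color_decode (b : bool) : color := if b then Black else White.
Lemma color_codeK : cancel color_code color_decode. Proof. by case. Qed.
HB.instance Definition _ := Equality.copy color (can_type color_codeK).

(* [None] is an empty position; so is every position outside the line. *)
Definition board := seq (option color).

Definition initial (c : seq color) : board := [seq Some x | x <- c].

(* [(i, j)]: the pawn at position [i] moves onto position [j]. *)
Definition move := (nat * nat)%type.

Definition adjacent (i j : nat) : bool := (i.+1 == j) || (j.+1 == i).

Definition legal (b : board) (m : move) : bool :=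
  adjacent m.1 m.2 &&
  match nth None b m.1, nth None b m.2 with
  | Some x, Some y => x != y
  | _, _ => false
  end.

Definition play1 (b : board) (m : move) : board :=
  set_nth None (set_nth None b m.2 (nth None b m.1)) m.1 None.

Fixpoint legal_game (b : board) (ms : seq move) : bool :=
  if ms is m :: ms' then legal b m && legal_game (play1 b m) ms' else true.

Definition pawns (b : board) : nat := count isSome b.

Definition reduces (c : seq color) (ms : seq move) (k : nat) : Prop :=
  legal_game (initial c) ms /\ pawns (foldl play1 (initial c) ms) = k.

(** * Words over Sigma and forbidden patterns *)

Inductive mark := Bar | Rgt | Lft.
Inductive base := BA | BS.

Definition mark_code (x : mark) : option bool :=
  match x with Bar => None | Rgt => Some true | Lft => Some false end.
Definition mark_decode (o : option bool) : mark :=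
  match o with None => Bar | Some true => Rgt | Some false => Lft end.
Lemma mark_codeK : cancel mark_code mark_decode. Proof. by case. Qed.
HB.instance Definition _ := Equality.copy mark (can_type mark_codeK).

Definition base_code (x : base) : bool := if x is BA then true else false.
Definition base_decode (b : bool) : base := if b then BA else BS.
Lemma base_codeK : cancel base_code base_decode. Proof. by case. Qed.
HB.instance Definition _ := Equality.copy base (can_type base_codeK).

Definition letter := (mark * base)%type.

(* The base [None] is the "don't care" letter [x]. *)
Definition pletter := (mark * option base)%type.
Definition pattern := seq pletter.

Definition matches (p : pletter) (l : letter) : bool :=
  (p.1 == l.1) && (if p.2 is Some b then b == l.2 else true).

Definition contains (v : seq letter) (p : pattern) : Prop :=
  exists u : seq letter, infix u v /\ all2 matches p u.

Definition Bx : pletter := (Bar, None).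
Definition Rx : pletter := (Rgt, None).
Definition Ra : pletter := (Rgt, Some BA).
Definition Rs : pletter := (Rgt, Some BS).
Definition Lx : pletter := (Lft, None).
Definition La : pletter := (Lft, Some BA).
Definition Ls : pletter := (Lft, Some BS).

Definition forbidden : seq pattern :=
  [:: [:: Lx; Rx];
      [:: Rs; Ls];
      [:: Bx; Rs]; [:: Ls; Bx];
      [:: Rx; Ra; Rx]; [:: Rx; Ra; Bx]; [:: Lx; La; Lx]; [:: Bx; La; Lx];
      [:: Bx; Ra; Ls]; [:: Rs; La; Bx];
      [:: Rx; Ra; La; Lx];
      [:: Bx; Ra; La; Bx]].

(* The base of the two added barred letters is irrelevant: in every pattern a
   barred letter has base [x]. *)
Definition padded (w : seq letter) : seq letter :=
  (Bar, BA) :: rcons w (Bar, BA).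

Definition encodes (c : seq color) (w : seq letter) : Prop :=
  size w = (size c).-1 /\
  forall i, i < size w ->
    (nth (Bar, BA) w i).2 = if nth Black c i == nth Black c i.+1 then BS else BA.

Definition barred (l : letter) : bool := l.1 == Bar.

(* The number of barred letters is [k - 1] in the integers, so [k = 0] is
   excluded. *)
Definition certificate (c : seq color) (k : nat) (w : seq letter) : Prop :=
  [/\ encodes c w,
      forall p, p \in forbidden -> ~ contains (padded w) p
    & (count barred w).+1 = k].

(** * Random access machines

    Cook-Reckhow random access machines, with unit cost per instruction.
    Arithmetic is restricted to successor and predecessor, so that after [t]
    steps no cell exceeds the largest constant or input item by more than [t],
    and unit cost cannot hide computation on long integers. *)

Inductive instr :=
  | Const of nat & nat   (* X_i <- v *)
  | Copy of nat & nat    (* X_i <- X_j *)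
  | Incr of nat          (* X_i <- X_i + 1 *)
  | Decr of nat          (* X_i <- X_i - 1, truncated at 0 *)
  | LoadAt of nat & nat    (* X_i <- X_(X_j) *)
  | StoreAt of nat & nat   (* X_(X_i) <- X_j *)
  | Jump of nat & nat    (* go to instruction l if X_i > 0 *)
  | Read of nat          (* X_i <- next input item, 0 at end of input *)
  | Print of nat.        (* append X_i to the output *)

Record config := Config {
  pc : nat;
  mem : nat -> nat;
  input : seq nat;
  output : seq nat }.

Definition upd (X : nat -> nat) (i v : nat) : nat -> nat :=
  fun j => if j == i then v else X j.

Definition exec (a : instr) (s : config) : config :=
  let: Config n X inp out := s in
  match a with
  | Const i v => Config n.+1 (upd X i v) inp out
  | Copy i j => Config n.+1 (upd X i (X j)) inp out
  | Incr i => Config n.+1 (upd X i (X i).+1) inp out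
  | Decr i => Config n.+1 (upd X i (X i).-1) inp out
  | LoadAt i j => Config n.+1 (upd X i (X (X j))) inp out
  | StoreAt i j => Config n.+1 (upd X (X i) (X j)) inp out
  | Jump i l => Config (if 0 < X i then l else n.+1) X inp out
  | Read i => Config n.+1 (upd X i (head 0 inp)) (behead inp) out
  | Print i => Config n.+1 X inp (rcons out (X i))
  end.

Definition program := seq instr.

(* The machine halts when the program counter leaves the program. *)
Definition halted (P : program) (s : config) : bool := size P <= pc s.

Definition step (P : program) (s : config) : config :=
  if halted P s then s else exec (nth (Const 0 0) P (pc s)) s.

Definition start (inp : seq nat) : config := Config 0 (fun=> 0) inp [::].

Definition computes_within (P : program) (inp out : seq nat) (t : nat) : Prop :=
  let s := iter t (step P) (start inp) in halted P s /\ output s = out.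

(* The codes are nonzero, so that 0 marks the end of the input word. *)
Definition letter_code (l : letter) : nat :=
  match l with
  | (Bar, BA) => 1 | (Bar, BS) => 2
  | (Rgt, BA) => 3 | (Rgt, BS) => 4
  | (Lft, BA) => 5 | (Lft, BS) => 6
  end.

Definition word_code (w : seq letter) : seq nat := [seq letter_code l | l <- w].

Definition moves_code (ms : seq move) : seq nat :=
  flatten [seq [:: m.1; m.2] | m <- ms].

(* Main.v *)
Require Import Defs.
From mathcomp Require Import all_boot zify.

(** A move empties a position for good, so each edge of the line is crossed at
    most once and the edges never crossed cut the line into segments, each of
    which ends up with one pawn.  Undoing a move shows that a segment can be
    reduced to one pawn only if the sequence of its edge bases is empty,
    [a s^m], [s^m a] or [a s^m a s^n a].  Conversely, the words over Sigma that
    avoid the patterns between two bars are exactly the empty word,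
    [Ra Rs^m], [Ls^m La], [Ra Rs^m La Ls^n La] and [Ra Rs^m Ra Ls^n La].  The
    last two have the same bases, hence the same solution: the leftmost pawn
    makes [m + 1] moves to the right, then the rightmost pawn makes
    [n + 2] moves to the left.  Counters are enough to print these moves in
    linear time while reading the word from left to right. *)

Set Implicit Arguments.
Unset Strict Implicit.
Unset Printing Implicit Defensive.

(** * Conformations as a first color followed by edge bases *)

Definition opp (x : color) : color := if x is Black then White else Black.

Definition shift_color (x : color) (b : base) : color :=
  if b is BS then x else opp x.

Definition edge_base (x y : color) : base := if x == y then BS else BA.

Notation colors := (scanl shift_color).

Lemma edge_baseK (x : color) : cancel (edge_base x) (shift_color x).
Proof. by case: x; case. Qed.

Lemma shift_colorK (x : color) : cancel (shift_color x) (edge_base x).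
Proof. by case: x; case. Qed.

Lemma colors_nseqS (x : color) (m : nat) : colors x (nseq m BS) = nseq m x.
Proof. by elim: m => //= m ->. Qed.

Lemma foldl_nseqS (x : color) (m : nat) :
  foldl shift_color x (nseq m BS) = x.
Proof. by elim: m. Qed.

Lemma encodesP (x : color) (c : seq color) (w : seq letter) :
  encodes (x :: c) w <-> unzip2 w = pairmap edge_base x c.
Proof.
split=> [[/= sz e]|e].
  apply: (@eq_from_nth _ BA); rewrite size_map ?size_pairmap // => i lti.
  by rewrite (nth_map (Bar, BA)) // e // (nth_pairmap Black) -?sz.
have sz : size w = size c by move: (congr1 size e); rewrite size_map size_pairmap.
split=> // i lti; move: (congr1 (fun s => nth BA s i) e).
by rewrite (nth_map (Bar, BA)) // (nth_pairmap Black) -?sz.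
Qed.

Lemma encodes_colors (x : color) (c : seq color) (w : seq letter) :
  encodes (x :: c) w -> c = colors x (unzip2 w).
Proof. by move/encodesP->; rewrite (pairmapK edge_baseK). Qed.

(** * Avoidance of the forbidden patterns *)

Definition bad (v : seq letter) : bool :=
  has (fun p => all2 matches p (take (size p) v)) forbidden.

(** [bad] inspects only the head of a word, so testing every suffix turns avoidance into a
    computation. A suffix shorter than a pattern never matches it, since [all2] fails on different
    sizes. *)
Fixpoint free (v : seq letter) : bool :=
  if v is l :: v' then ~~ bad v && free v' else true.

Lemma free_catr (u v : seq letter) : free (u ++ v) -> free v.
Proof. by elim: u => //= l u IH /andP[_ /IH]. Qed.

Lemma all2_size (p : pattern) (u : seq letter) :
  all2 matches p u -> size p = size u.
Proof. by elim: p u => [|a p IH] [|b u] //= /andP[_ /IH ->]. Qed.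

Lemma freeP (v : seq letter) :
  (forall p, p \in forbidden -> ~ contains v p) <-> free v.
Proof.
split=> [|fv p pin [u [/infixP[s1 [s2 ev]] pu]]]; last first.
  move: fv; rewrite ev => /free_catr.
  have : bad (u ++ s2).
    by apply/hasP; exists p => //; rewrite (all2_size pu) take_size_cat.
  by case: (u ++ s2) => //= l r ->.
elim: v => //= l v IH nc; apply/andP; split.
  apply/hasP => -[p pin pm]; apply: (nc p pin); eexists; split; last exact: pm.
  by apply/prefixW/prefixP; exists (drop (size p) (l :: v)); rewrite cat_take_drop.
apply: IH => p pin [u [/infixP[s1 [s2 ev]] pu]]; apply: (nc p pin).
by exists u; split=> //; apply/infixP; exists (l :: s1), s2; rewrite ev.
Qed.

Lemma free_catl (u v : seq letter) : free (u ++ v) -> free u.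
Proof.
move=> /freeP fuv; apply/freeP => p pin [z [zi pz]]; apply: (fuv p pin).
exists z; split=> //; apply: (infix_trans zi); apply/infixP.
by exists [::], v.
Qed.

(* Barred letters occur only at the two ends of a forbidden pattern. *)
Lemma free_cat_bar (b b' : base) (l : letter) (u v : seq letter) :
  ~~ has barred u -> free (l :: rcons u (Bar, b)) -> free ((Bar, b') :: v) ->
  free (l :: u ++ (Bar, b') :: v).
Proof.
elim: u l => [|l' u IH] l nb.
  rewrite [free (l :: _ ++ _)]/= => /= /andP[h _] /= ->; rewrite andbT.
  by move: h; case: l => [[] []]; case: b => //; case: (v).
rewrite rcons_cons => /andP[h1 h2] h3.
move: (nb) => /= /norP[nb1 nb2].
change (~~ bad (l :: l' :: u ++ (Bar, b') :: v) && free (l' :: u ++ (Bar, b') :: v)).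
rewrite (IH _ nb2 h2 h3) andbT.
(* A pattern has at most four letters, so besides [l] and [l'] only two letters of what follows can
   matter. *)
move: nb h1; clear.
case: l => [[] []]; case: l' => [[] []] //;
  (case: u => [|[[] []] [|[[] []] u]] //=); try by case: v => [|? []].
all: by rewrite /bad /= ?take0.
Qed.

(** * Words between two bars *)

Inductive segment : seq letter -> Prop :=
  | SegNil : segment [::]
  | SegR m : segment ((Rgt, BA) :: nseq m (Rgt, BS))
  | SegL m : segment (nseq m (Lft, BS) ++ [:: (Lft, BA)])
  | SegRL d m n : d != Bar ->
      segment ((Rgt, BA) :: nseq m (Rgt, BS) ++
               (d, BA) :: nseq n (Lft, BS) ++ [:: (Lft, BA)]).

(** [Lx Rx] keeps all later arrows to the left, [Ls Bx] makes the last one [La], and [Lx La Lx]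
    excludes any [La] of [u] before the last. *)
Lemma left_run (x b : base) (u : seq letter) :
  ~~ has barred u -> free ((Lft, x) :: rcons u (Bar, b)) ->
  u = [::] /\ x = BA \/ exists n, u = nseq n (Lft, BS) ++ [:: (Lft, BA)].
Proof.
elim: u x => [|[d y] u IH] x.
  by case: x; case: (b) => //= _ _; left.
move=> /= /norP[nb nbu] /andP[h fu].
have ed : d = Lft by case: d nb h {fu} => //; case: x; case: y; rewrite /bad /= ?take0.
move: {nb} h fu; rewrite {d}ed => h fu.
right; case: (IH y nbu fu) => [[-> ->]|[n eu]]; first by exists 0.
exists n.+1; rewrite eu /=; congr cons; congr pair.
by move: h; rewrite eu; case: y {fu} => //; case: n {eu} => [|n]; case: x; rewrite /bad /= ?take0.
Qed.

(** The third case, where left arrows start right after an [Ra], is kept apart because the letter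
    before that [Ra] decides: a right arrow turns it into the second case with [d = Rgt], while a
    bar is excluded by [Bx Ra Ls] and [Bx Ra La Bx]. *)
Lemma right_run (x b : base) (u : seq letter) :
  ~~ has barred u -> free ((Rgt, x) :: rcons u (Bar, b)) ->
  [\/ exists m, u = nseq m (Rgt, BS),
      exists d m n, d != Bar /\ u = nseq m (Rgt, BS) ++
               (d, BA) :: nseq n (Lft, BS) ++ [:: (Lft, BA)]
    | x = BA /\ exists n, u = nseq n (Lft, BS) ++ [:: (Lft, BA)]].
Proof.
elim: u x => [|[d y] u IH] x; first by move=> _ _; constructor 1; exists 0.
move=> /= /norP[nb nbu] /andP[h fu].
case: d nb h fu => // _ h fu.
  case: (IH y nbu fu) => [[m eu]|[d [m [n [nd eu]]]]|[ey [n eu]]].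
  - case: y {fu} h => h; last by constructor 1; exists m.+1; rewrite eu.
    by case/negP: h; rewrite eu; case: m {eu} => [|m]; case: x; case: (b); rewrite /bad /= ?take0.
  - case: y {fu} h => h; last by constructor 2; exists d, m.+1, n; rewrite eu.
    case/negP: h; rewrite eu; case: m {eu} => [|m]; case: x; case: d nd => //;
      case: n => [|n]; rewrite /bad /= ?take0 //.
  - by constructor 2; exists Rgt, 0, n; rewrite ey eu.
have [[eu ey]|[n eu]] := left_run nbu fu.
  rewrite {}eu {}ey in h *; case: x h => [_|].
    by constructor 3; split=> //; exists 0.
  by case: (b).
case: y h {fu} => h.
  by constructor 2; exists Lft, 0, n; rewrite eu.
case: x h => h.
  by constructor 3; split=> //; exists n.+1; rewrite eu.
by case/negP: h; rewrite /bad /= ?take0.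
Qed.

(** The bar on the left fixes the first arrow: [Bx Rs] excludes [Rs], and [Bx La Lx] allows [La]
    only when it is the whole segment. *)
Lemma free_segment (b b' : base) (u : seq letter) :
  ~~ has barred u -> free ((Bar, b') :: rcons u (Bar, b)) -> segment u.
Proof.
case: u => [|[d x] u]; first by constructor.
move=> /= /norP[nb nbu] /andP[h fu]; case: d nb h fu => // _ h fu.
  have ex : x = BA by case: x h {fu} => //; rewrite /bad /= ?take0.
  rewrite {x}ex in h fu *.
  have [[m ->]|[d [m [n [nd ->]]]]|[_ [n eu]]] := right_run nbu fu.
  - exact: SegR.
  - exact: SegRL.
  case/negP: h; rewrite eu; case: n {eu} => [|n]; case: (b'); case: (b); rewrite /bad /= ?take0 //.
have [[-> ->]|[n eu]] := left_run nbu fu; first exact: (SegL 0).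
rewrite eu; case: x h {fu} => h; last exact: (SegL n.+1).
by case/negP: h; rewrite eu; case: n {eu} => [|n]; case: (b'); rewrite /bad /= ?take0.
Qed.

(** The cut is made at the first bar, which both closes one segment and opens the rest. *)
Lemma free_parse (b : base) (w : seq letter) : free ((Bar, b) :: rcons w (Bar, BA)) ->
  segment w \/
  exists u b' v, [/\ segment u, w = u ++ (Bar, b') :: v
                  & free ((Bar, b') :: rcons v (Bar, BA))].
Proof.
move=> fw; case hb: (has barred w); last by left; apply: free_segment fw; rewrite hb.
right; move: fw; case/split_find: hb => -[d b'] u v /eqP ed nb.
rewrite -[d]/((d, b').1) {}ed.
rewrite cat_rcons rcons_cat => fw; exists u, b', v; split=> //; last first.
  exact: (@free_catr ((Bar, b) :: u)).
apply: (@free_segment b' b) => //.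
by apply: (@free_catl _ (rcons v (Bar, BA))); rewrite /= cat_rcons.
Qed.

(** * Playing a word *)

Fixpoint right_moves (i p : nat) : seq move :=
  if p is p'.+1 then (i, i.+1) :: right_moves i.+1 p' else [::].

Fixpoint left_moves (i q : nat) : seq move :=
  if q is q'.+1 then (i, i.-1) :: left_moves i.-1 q' else [::].

(* [i] is the current edge, [q] the number of pending moves to the left, and
   [r] tells whether the current segment has already seen a right arrow.  A
   letter [Ra] that does not start its segment is handled as [La]: the pawn
   coming from the right can cross that edge as well. *)
Fixpoint solution (i q : nat) (r : bool) (w : seq letter) : seq move :=
  match w with
  | [::] => left_moves i q
  | (Bar, _) :: w' => left_moves i q ++ solution i.+1 0 false w'
  | (Rgt, b) :: w' =>
    if r && (b == BA) then solution i.+1 q.+1 r w'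
    else (i, i.+1) :: solution i.+1 q true w'
  | (Lft, _) :: w' => solution i.+1 q.+1 r w'
  end.

Lemma solution_cat (i q : nat) (r : bool) (u : seq letter) (b : base) (v : seq letter) :
  ~~ has barred u ->
  solution i q r (u ++ (Bar, b) :: v) =
  solution i q r u ++ solution (i + size u).+1 0 false v.
Proof.
elim: u i q r => [|[[] y] u IH] i q r //=; first by rewrite addn0.
  by move=> nb; rewrite !IH // addSnnS; case: ifP.
by move=> nb; rewrite IH // addSnnS.
Qed.

Lemma solution_right (i m : nat) (v : seq letter) :
  solution i 0 true (nseq m (Rgt, BS) ++ v) =
  right_moves i m ++ solution (i + m) 0 true v.
Proof. by elim: m i => [|m IH] i /=; rewrite ?addn0 // IH addSnnS. Qed.

Lemma solution_left (i q n : nat) (r : bool) :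
  solution i q r (nseq n (Lft, BS) ++ [:: (Lft, BA)]) =
  left_moves (i + n.+1) (q + n.+1).
Proof. by elim: n i q => [|n IH] i q /=; rewrite ?addn1 // IH !addSnnS. Qed.

(** * Sweeps of a pawn along the board *)

Lemma set_nth_cat (T : Type) (x0 y : T) (s t : seq T) (i : nat) :
  set_nth x0 (s ++ t) (size s + i) y = s ++ set_nth x0 t i y.
Proof. by elim: s => //= x s ->. Qed.

Lemma oppK : involutive opp. Proof. by case. Qed.

Lemma legal_catE (pre b : board) (i j : nat) :
  legal (pre ++ b) (size pre + i, size pre + j) = legal b (i, j).
Proof.
by rewrite /legal /adjacent /= -!addnS !eqn_add2l !nth_cat !ltnNge !leq_addr /= !addKn.
Qed.

Lemma play1_cat (pre b : board) (i j : nat) :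
  play1 (pre ++ b) (size pre + i, size pre + j) = pre ++ play1 b (i, j).
Proof.
by rewrite /play1 /= nth_cat ltnNge leq_addr addKn !set_nth_cat.
Qed.

(** The moving pawn keeps its color, so it can take each next [y] in turn; the position it leaves
    joins [pre] in the induction. *)
Lemma right_moves_game (x y : color) (p : nat) (pre post : board) : x != y ->
  let b := pre ++ Some x :: nseq p (Some y) ++ post in
  legal_game b (right_moves (size pre) p) /\
  foldl play1 b (right_moves (size pre) p) = pre ++ nseq p None ++ Some x :: post.
Proof.
move=> nxy; elim: p pre => //= p IH pre.
have -> : (size pre, (size pre).+1) = (size pre + 0, size pre + 1) by rewrite addn0 addn1.
rewrite legal_catE play1_cat /legal /= nxy /play1 /=.
have := IH (rcons pre None); rewrite !cat_rcons size_rcons.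
by [].
Qed.

Lemma cat_nseqS (T : Type) (x : T) (n : nat) (s : seq T) :
  nseq n x ++ x :: s = x :: nseq n x ++ s.
Proof. by elim: n => //= n ->. Qed.

Lemma left_moves_game (x y : color) (q : nat) (pre post : board) : x != y ->
  let b := pre ++ nseq q (Some y) ++ Some x :: post in
  legal_game b (left_moves (size pre + q) q) /\
  foldl play1 b (left_moves (size pre + q) q) = pre ++ Some x :: nseq q None ++ post.
Proof.
move=> nxy; elim: q post => [|q IH] post //=.
(* One [y] is brought to the end of the block, next to the pawn that takes it. *)
rewrite addnS /= -addnS -cat_nseqS catA.
have e j : size pre + (q + j) = size (pre ++ nseq q (Some y)) + j.
  by rewrite size_cat size_nseq addnA.
rewrite -[X in (_, size pre + X)]addn0 -[q.+1]addn1 !e legal_catE play1_cat /legal /= nxy /play1 /=.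
by have := IH (None :: post); rewrite cat_nseqS catA.
Qed.

Lemma segment_nbar (u : seq letter) : segment u -> ~~ has barred u.
Proof.
case=> [|m|m|[] m n //= _] //=;
  by rewrite ?(has_cat, has_nseq, andbF) //= ?(has_cat, has_nseq, andbF).
Qed.

Lemma legal_game_cat (b : board) (ms ms' : seq move) :
  legal_game b (ms ++ ms') =
  legal_game b ms && legal_game (foldl play1 b ms) ms'.
Proof. by elim: ms b => //= m ms IH b; rewrite IH andbA. Qed.

Lemma segment_game (u : seq letter) (x : color) (pre post : board) : segment u ->
  let b := pre ++ initial (x :: colors x (unzip2 u)) ++ post in
  let ms := solution (size pre) 0 false u in
  exists s, [/\ size s = (size u).+1, pawns s = 1, legal_game b ms
              & foldl play1 b ms = pre ++ s ++ post].
Proof.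
have nx y : opp y != y by case: y.
have nx' y : y != opp y by case: y.
move=> su b ms; rewrite {}/b {}/ms.
have pn n : pawns (nseq n None) = 0 by rewrite /pawns count_nseq.
case: su => [|m|m|d m n nd].
- by exists [:: Some x].
- have -> : solution (size pre) 0 false ((Rgt, BA) :: nseq m (Rgt, BS)) =
            right_moves (size pre) m.+1.
    by rewrite /= -[nseq m _]cats0 solution_right cats0.
  rewrite /unzip2 /= map_nseq colors_nseqS /initial /= map_nseq.
  have [gl gf] := right_moves_game m.+1 pre post (nx' x).
  exists (nseq m.+1 None ++ [:: Some x]); split=> //; last by rewrite -catA.
    by rewrite size_cat !size_nseq addn1.
  by rewrite /pawns count_cat -/(pawns _) pn.
- rewrite solution_left.
  have -> : initial (x :: colors x (unzip2 (nseq m (Lft, BS) ++ [:: (Lft, BA)]))) ++ post =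
            nseq m.+1 (Some x) ++ Some (opp x) :: post.
    rewrite /unzip2 map_cat map_nseq scanl_cat colors_nseqS foldl_nseqS.
    by rewrite /initial /= map_cat map_nseq /= -catA.
  have [gl gf] := left_moves_game m.+1 pre post (nx x).
  exists (Some (opp x) :: nseq m.+1 None); split=> //.
    by rewrite /= size_cat !size_nseq addn1.
  by rewrite /pawns /= -/(pawns _) pn.
- have -> : solution (size pre) 0 false ((Rgt, BA) :: nseq m (Rgt, BS) ++
               (d, BA) :: nseq n (Lft, BS) ++ [:: (Lft, BA)]) =
     right_moves (size pre) m.+1 ++ left_moves (size pre + m.+1 + n.+2) n.+2.
    rewrite /= solution_right addSnnS.
    have -> v i : solution i 0 true ((d, BA) :: v) = solution i.+1 1 true v by case: d nd.
    by rewrite solution_left add1n addSnnS.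
  have -> : initial (x :: colors x (unzip2 ((Rgt, BA) :: nseq m (Rgt, BS) ++
               (d, BA) :: nseq n (Lft, BS) ++ [:: (Lft, BA)]))) ++ post =
      Some x :: nseq m.+1 (Some (opp x)) ++ nseq n.+1 (Some x) ++ Some (opp x) :: post.
    rewrite /unzip2 /= map_cat map_nseq scanl_cat colors_nseqS foldl_nseqS.
    rewrite /= oppK map_cat map_nseq scanl_cat colors_nseqS foldl_nseqS /=.
    by rewrite /initial /= !map_cat !map_nseq /= map_cat map_nseq /= -!catA /= -catA.
  (* The first sweep brings its pawn of color [x] next to [n.+1] others, so the last pawn then faces
     [n.+2] opponents. *)
  have [gl gf] := right_moves_game m.+1 pre (nseq n.+1 (Some x) ++ Some (opp x) :: post) (nx' x).
  have [gl' gf'] := left_moves_game n.+2 (pre ++ nseq m.+1 None) post (nx x).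
  have ez : pre ++ nseq m.+1 None ++ Some x :: nseq n.+1 (Some x) ++ Some (opp x) :: post =
      (pre ++ nseq m.+1 None) ++ nseq n.+2 (Some x) ++ Some (opp x) :: post by rewrite -catA.
  have sz : size pre + m.+1 = size (pre ++ nseq m.+1 (@None color)).
    by rewrite size_cat size_nseq.
  rewrite -sz in gl' gf'.
  exists (nseq m.+1 None ++ Some (opp x) :: nseq n.+2 None); split.
  + by rewrite /= !size_cat /= !size_cat !size_nseq /= !addnS addn0.
  + by rewrite /pawns count_cat /= -!/(pawns _) !pn.
  + by rewrite legal_game_cat gl gf ez.
  + by rewrite foldl_cat gf ez gf' -!catA.
Qed.

(** Induction on the size of [w]: once the first segment is played, its positions join [pre], and
    the next bar starts the same situation again. *)
Lemma solution_game (w : seq letter) (x : color) (b : base) (pre : board) :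
  free ((Bar, b) :: rcons w (Bar, BA)) ->
  let c := pre ++ initial (x :: colors x (unzip2 w)) in
  let ms := solution (size pre) 0 false w in
  legal_game c ms /\
  pawns (foldl play1 c ms) = pawns pre + (count barred w).+1.
Proof.
have [n] := ubnP (size w); elim: n => // n IH in w x b pre *.
rewrite ltnS => szw fw c ms; rewrite {}/c {}/ms.
case: (free_parse fw) => [su|[u [b' [v [su ew fv]]]]].
  have [s [_ ps gl gf]] := segment_game x pre [::] su.
  rewrite !cats0 in gl gf.
  rewrite gl gf /pawns count_cat -!/(pawns _) ps.
  by move: (segment_nbar su); rewrite has_count -eqn0Ngt => /eqP->.
rewrite {w}ew in szw fw *.
pose x' := shift_color (foldl shift_color x (unzip2 u)) b'.
have -> : initial (x :: colors x (unzip2 (u ++ (Bar, b') :: v))) =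
    initial (x :: colors x (unzip2 u)) ++ initial (x' :: colors x' (unzip2 v)).
  by rewrite /unzip2 map_cat scanl_cat -cat_cons /initial map_cat.
have [s [sz ps gl gf]] :=
  segment_game x pre (initial (x' :: colors x' (unzip2 v))) su.
have szp : (size pre + size u).+1 = size (pre ++ s) by rewrite size_cat sz addnS.
have [|gl' gf'] := IH v x' b' (pre ++ s) _ fv.
  by apply: leq_trans szw; rewrite size_cat /= ltn_addl.
have nbu := segment_nbar su.
rewrite solution_cat // szp legal_game_cat gl gf foldl_cat gf catA gl' gf'.
split=> //; rewrite /pawns !count_cat -!/(pawns _) ps /=.
by move: nbu; rewrite has_count -eqn0Ngt => /eqP->; rewrite add0n add1n -addnA !addSn.
Qed.

(** * From games to words *)

Definition flip (b : base) : base := if b is BS then BA else BS.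

Inductive one_pawn_word : seq base -> Prop :=
  | OneNil : one_pawn_word [::]
  | OneR m : one_pawn_word (BA :: nseq m BS)
  | OneL m : one_pawn_word (rcons (nseq m BS) BA)
  | OneRL m n : one_pawn_word (BA :: nseq m BS ++ BA :: rcons (nseq n BS) BA).

(** This is the effect on bases of undoing a move of the first pawn to the right: the new first edge
    has base [BA], and the old first base is flipped because the restored pawn has the opposite
    color. *)
Lemma one_pawn_word_cons (b : base) (t : seq base) :
  one_pawn_word (b :: t) -> one_pawn_word [:: BA, flip b & t].
Proof.
move ev: (b :: t) => v ow; case: ow ev => [//|m|m|m n].
- by case=> -> ->; exact: (OneR m.+1).
- by case: m => [|m] [-> ->]; [exact: (OneR 1)|exact: (OneRL 0 m)].
- by case=> -> ->; exact: (OneRL m.+1 n).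
Qed.

Lemma one_pawn_word_rcons (t : seq base) (b : base) :
  one_pawn_word (rcons t b) -> one_pawn_word (rcons (rcons t (flip b)) BA).
Proof.
have nS n : rcons (nseq n BS) BS = nseq n.+1 BS by elim: n => //= n ->.
move ev: (rcons t b) => v ow; case: ow ev => [|m|m|m n].
- by case: t.
- case: m => [|m]; first by case: t => [[->]|? []//]; exact: (OneL 1).
  rewrite -nS -rcons_cons => /rcons_inj[-> ->].
  by have := OneRL m 0; rewrite /= -cat_rcons cats1.
- by move=> /rcons_inj[-> ->]; rewrite /= nS; exact: OneL.
- rewrite -rcons_cons -rcons_cat -rcons_cons => /rcons_inj[-> ->] /=.
  by rewrite !rcons_cat /= nS; exact: (OneRL m n.+1).
Qed.

Definition one_pawn (s : seq color) : Prop :=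
  exists x t, s = x :: colors x t /\ one_pawn_word t.

Lemma one_pawn_cons (x : color) (s : seq color) :
  one_pawn (x :: s) -> one_pawn [:: x, opp x & s].
Proof.
case=> y [[|b t] [[-> ->] ow]].
  by exists y, [:: BA]; split=> //; exact: (OneR 0).
exists y, [:: BA, flip b & t]; split; last exact: one_pawn_word_cons.
by case: b {ow}; rewrite /= ?oppK.
Qed.

Lemma one_pawn_rcons (s : seq color) (x : color) :
  one_pawn (rcons s x) -> one_pawn (rcons (rcons s (opp x)) x).
Proof.
case=> y [t [es ow]]; case/lastP: t ow es => [|t b] ow.
  case: s => [|? []] //= [->].
  by exists (opp y), [:: BA]; rewrite /= oppK; split=> //; exact: (OneR 0).
rewrite -!cats1 scanl_cat -cat_cons !cats1 => /rcons_inj[-> ->].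
exists y, (rcons (rcons t (flip b)) BA); split; last exact: one_pawn_word_rcons.
rewrite -!cats1 !scanl_cat foldl_cat /=.
by case: b {ow}; rewrite /= ?oppK.
Qed.

(* [splits b k]: [b] consists of empty positions and [k] one-pawn segments. *)
Inductive splits : board -> nat -> Prop :=
  | SplitsNil : splits [::] 0
  | SplitsNone b k : splits b k -> splits (None :: b) k
  | SplitsSome s b k :
      one_pawn s -> splits b k -> splits (initial s ++ b) k.+1.

Lemma splits_cat (b b' : board) (k k' : nat) :
  splits b k -> splits b' k' -> splits (b ++ b') (k + k').
Proof.
move=> sb sb'; elim: sb => {b k} [|b k _ IH|s b k os _ IH] //=.
  exact: SplitsNone.
by rewrite -catA; exact: SplitsSome.
Qed.

Lemma splits_pawns (b : board) : splits b (pawns b).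
Proof.
elim: b => [|[x|] b IH]; [exact: SplitsNil| |exact: SplitsNone].
by apply: (@SplitsSome [:: x]) => //; exists x, [::]; split=> //; exact: OneNil.
Qed.

(** Segments have no empty position, so a [None] cannot fall inside one and separates those on its
    two sides. *)
Lemma splits_None_inv (b b' : board) (k : nat) :
  splits (b ++ None :: b') k ->
  exists k1 k2, [/\ splits b k1, splits b' k2 & k = k1 + k2].
Proof.
move ev: (b ++ None :: b') => v sv.
elim: sv b ev => {v k} [|v k sv IH|s v k os sv IH] b.
- by case: b.
- case: b => [|x b] /=; first by case=> ->; exists 0, k; split=> //; exact: SplitsNil.
  case=> -> /IH[k1 [k2 [s1 s2 ->]]].
  by exists k1, k2; split=> //; exact: SplitsNone.
move=> ev; suff [b1 eb] : exists b1, b = initial s ++ b1.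
  move: ev; rewrite eb -catA => /eqP; rewrite eqseq_cat // eqxx => /eqP/IH.
  case=> [k1 [k2 [s1 s2 ->]]].
  by exists k1.+1, k2; split=> //; exact: SplitsSome.
elim: s b ev {os} => [|x s IHs] [|y b] //=; first by exists [::].
  by exists (y :: b).
by case=> -> /IHs[b1 ->]; exists b1.
Qed.

Lemma splits_head_inv (x : color) (b : board) (k : nat) :
  splits (Some x :: b) k ->
  exists s b' k',
    [/\ one_pawn (x :: s), splits b' k', b = initial s ++ b' & k = k'.+1].
Proof.
move ev: (Some x :: b) => v sv; case: sv ev => // s b' k' os sb'.
case: (os) => y [t [es _]]; rewrite es => -[ex eb].
by exists (colors y t), b', k'; split=> //; rewrite ex -es.
Qed.

Lemma splits_last_inv (x : color) (b : board) (k : nat) :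
  splits (rcons b (Some x)) k ->
  exists s b' k',
    [/\ one_pawn (rcons s x), splits b' k', b = b' ++ initial s & k = k'.+1].
Proof.
move ev: (rcons b (Some x)) => v sv.
elim: sv b ev => {v k} [|v k sv IH|s v k os sv IH] b; first by case: b.
  case: b => [|y b] //= [-> /IH[s [b' [k' [os sb' -> ->]]]]].
  by exists s, (None :: b'), k'; split=> //; exact: SplitsNone.
case/lastP: v sv IH => [|v y] sv IH.
  rewrite cats0; case/lastP: s os => [|s y] os; first by case: b.
  rewrite /initial map_rcons => /rcons_inj[-> ->].
  by exists s, [::], k; split=> //; exact: sv.
rewrite -rcons_cat => /rcons_inj[-> ey].
case: (IH v); first by rewrite ey.
move=> s' [b' [k' [os' sb' -> ->]]].
exists s', (initial s ++ b'), k'.+1; split=> //; last by rewrite catA.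
exact: SplitsSome.
Qed.

Lemma nth_split (T : Type) (x0 : T) (s : seq T) (i : nat) :
  i.+1 < size s ->
  exists2 s1, i = size s1 & exists s2, s = s1 ++ [:: nth x0 s i, nth x0 s i.+1 & s2].
Proof.
move=> lti; exists (take i s); first by rewrite size_takel // ltnW // ltnW.
exists (drop i.+2 s).
by rewrite -{1}(cat_take_drop i s) (drop_nth x0) ?(drop_nth x0 lti) // ltnW.
Qed.

Lemma legal_split (b : board) (m : move) : legal b m ->
  exists pre x post,
    m = (size pre, (size pre).+1) /\ b = pre ++ [:: Some x, Some (opp x) & post] \/
    m = ((size pre).+1, size pre) /\ b = pre ++ [:: Some (opp x), Some x & post].
Proof.
have sz y j : nth None b j = Some y -> j < size b.
  by move=> e; case: ltnP => // /(nth_default None); rewrite e.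
have neq (y z : color) : y != z -> z = opp y by case: y; case: z.
case: m => i j; rewrite /legal /=.
case ei: (nth None b i) => [x|]; last by rewrite andbF.
case ej: (nth None b j) => [y|]; last by rewrite andbF.
case/andP=> /orP[] /eqP eij /neq ey; rewrite {y}ey in ej.
  rewrite -eij in ej *; have [pre ep [post eb]] := nth_split None (sz _ _ ej).
  by exists pre, x, post; left; rewrite -ep {1}eb ei ej.
rewrite -eij in ei *; have [pre ep [post eb]] := nth_split None (sz _ _ ei).
by exists pre, x, post; right; rewrite -ep {1}eb ei ej.
Qed.

(** The position left by the move is empty and cuts the decomposition there. The moved pawn ends the
    adjacent segment; undoing the move lengthens this segment by one position and keeps the number
    of segments. *)
Lemma splits_play1 (b : board) (m : move) (k : nat) :
  legal b m -> splits (play1 b m) k -> splits b k.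
Proof.
case/legal_split=> pre [x [post []]] [-> ->].
  have -> : (size pre, (size pre).+1) = (size pre + 0, size pre + 1) by rewrite addn0 addn1.
  rewrite play1_cat /play1 /=.
  case/splits_None_inv=> k1 [k2 [s1 /splits_head_inv]].
  case=> s [b' [k' [os sb' -> ->]]] ->; apply: splits_cat => //.
  exact: (SplitsSome (one_pawn_cons os) sb').
have -> : ((size pre).+1, size pre) = (size pre + 1, size pre + 0) by rewrite addn0 addn1.
rewrite play1_cat /play1 /= -cat_rcons.
case/splits_None_inv=> k1 [k2 [/splits_last_inv]].
case=> s [b' [k' [os sb' -> ->]]] s2 ->.
have := splits_cat sb' (SplitsSome (one_pawn_rcons os) s2).
by rewrite /initial !map_rcons !cat_rcons -catA addSnnS.
Qed.

Lemma splits_game (b : board) (ms : seq move) :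
  legal_game b ms -> splits b (pawns (foldl play1 b ms)).
Proof.
elim: ms b => [|m ms IH] b /=; first by move=> _; exact: splits_pawns.
by case/andP=> lm /IH; apply: splits_play1.
Qed.

Lemma one_pawn_word_free (t : seq base) (b b' : base) : one_pawn_word t ->
  exists u, [/\ ~~ has barred u, unzip2 u = t
              & free ((Bar, b) :: rcons u (Bar, b'))].
Proof.
pose lefts n := nseq n (Lft, BS) ++ [:: (Lft, BA); (Bar, b')].
have fl n : free (lefts n).
  elim: n => [|n IH]; first by case: (b').
  change (~~ bad ((Lft, BS) :: lefts n) && free (lefts n)); rewrite IH andbT.
  (* [bad] reads at most four letters, so a few unrolled letters settle every [n]. *)
  by case: n {IH} => [|[|[|[|n]]]]; case: (b').
case=> [|m|m|m n].
- by exists [::]; split=> //; case: (b); case: (b').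
- exists ((Rgt, BA) :: nseq m (Rgt, BS)); split.
  + by rewrite /= has_nseq andbF.
  + by rewrite /unzip2 /= map_nseq.
  rewrite -cats1 cat_cons.
  pose r m := nseq m (Rgt, BS) ++ [:: (Bar, b')].
  have fr j : free (r j).
    elim: j => [|j IH]; first by case: (b').
    change (~~ bad ((Rgt, BS) :: r j) && free (r j)); rewrite IH andbT.
    by case: j {IH} => [|[|[|[|j]]]]; case: (b').
  change ([&& ~~ bad [:: (Bar, b), (Rgt, BA) & r m], ~~ bad ((Rgt, BA) :: r m) & free (r m)]).
  by rewrite fr; case: (m) => [|[|[|[|?]]]]; case: (b); case: (b').
- exists (nseq m (Lft, BS) ++ [:: (Lft, BA)]); split.
  + by rewrite has_cat has_nseq andbF.
  + by rewrite /unzip2 map_cat map_nseq cats1.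
  rewrite -cats1 -catA.
  change (~~ bad ((Bar, b) :: lefts m) && free (lefts m)).
  by rewrite fl; case: (m) => [|[|[|[|?]]]]; case: (b); case: (b').
(* Of the two words with these bases, the one that turns with [La] is chosen. *)
exists ((Rgt, BA) :: nseq m (Rgt, BS) ++ (Lft, BA) :: nseq n (Lft, BS) ++ [:: (Lft, BA)]).
split.
- by rewrite /= has_cat has_nseq andbF /= has_cat has_nseq andbF.
- by rewrite /unzip2 /= map_cat map_nseq /= map_cat map_nseq cats1.
rewrite -cats1 cat_cons -catA cat_cons -catA.
pose r m := nseq m (Rgt, BS) ++ (Lft, BA) :: lefts n.
have fr j : free (r j).
  elim: j => [|j IH].
    change (~~ bad ((Lft, BA) :: lefts n) && free (lefts n)); rewrite fl andbT.
    by case: (n) => [|[|[|[|?]]]]; case: (b').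
  change (~~ bad ((Rgt, BS) :: r j) && free (r j)); rewrite IH andbT {IH} /r.
  by case: j => [|[|[|[|j]]]]; case: (n) => [|[|[|[|?]]]]; case: (b').
change ([&& ~~ bad [:: (Bar, b), (Rgt, BA) & r m], ~~ bad ((Rgt, BA) :: r m) & free (r m)]).
by rewrite fr /r; case: (m) => [|[|[|[|?]]]]; case: (n) => [|[|[|[|?]]]]; case: (b); case: (b').
Qed.

Lemma splits_nil (k : nat) : splits [::] k -> k = 0.
Proof.
move ev: [::] => v sv; case: sv ev => // s b k' os _.
by case: os => x [t [->]].
Qed.

(** On a full line the segments are contiguous, with one bar at each junction, hence one bar fewer
    than segments. The base [b] is general because each junction bar opens the next word. *)
Lemma splits_word (c : board) (k : nat) (x : color) (s : seq color) (b : base) :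
  splits c k -> c = initial (x :: s) ->
  exists w, [/\ unzip2 w = pairmap edge_base x s, (count barred w).+1 = k
              & free ((Bar, b) :: rcons w (Bar, BA))].
Proof.
move=> sc; elim: sc x s b => {c k} [|c k _ _|s' c k os sc IH] x s b //.
case: os => y [t [-> ot]] /= [->{y} ec].
have [u [nbu eu fu]] := one_pawn_word_free b BA ot.
have cu : count barred u = 0.
  by move: nbu; rewrite has_count -eqn0Ngt => /eqP.
have {ec} [s2 [-> ec]] : exists s2, s = colors x t ++ s2 /\ c = initial s2.
  elim: (colors x t) s ec => [|a l IHl] s /= ec; first by exists s.
  by case: s ec => //= a' s [<- /IHl[s2 [-> ->]]]; exists s2.
case: s2 ec => [|y s2] ec.
  exists u; split=> //; first by rewrite cats0 (scanlK shift_colorK).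
  by rewrite ec in sc; rewrite cu (splits_nil sc).
pose b' := edge_base (last x (colors x t)) y.
have [v [ev cv fv]] := IH y s2 b' ec.
exists (u ++ (Bar, b') :: v); split.
- by rewrite /unzip2 map_cat -/(unzip2 u) eu /= -/(unzip2 v) ev pairmap_cat (scanlK shift_colorK).
- by rewrite count_cat cu /= -cv.
- by rewrite rcons_cat rcons_cons; exact: free_cat_bar nbu fu fv.
Qed.

Lemma reduces_certificate (x : color) (c : seq color) (k : nat) (ms : seq move) :
  reduces (x :: c) ms k -> exists w, certificate (x :: c) k w.
Proof.
case=> /splits_game + kE; rewrite kE => sc.
have [w [ew cw fw]] := splits_word BA sc erefl.
by exists w; split=> //; [apply/encodesP|apply/freeP].
Qed.

Lemma certificate_reduces (x : color) (c : seq color) (k : nat) (w : seq letter) :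
  certificate (x :: c) k w -> reduces (x :: c) (solution 0 0 false w) k.
Proof.
case=> /encodes_colors -> /freeP fw <-.
by have [gl gf] := solution_game x [::] fw; split.
Qed.

(** * The linear-time machine *)

(* X1, X2 and X3 hold the arguments [i], [q] and [r] of [solution], and X5 is
   the constant 1 of unconditional jumps.  Numbers in comments are addresses of
   instructions. *)
Definition solver : program :=
  [:: Const 5 1;
      Read 0;             (* 1: next letter *)
      Copy 4 0; Decr 4; Decr 4; Jump 4 18;
      Copy 4 1;           (* 6: barred letter or end of the word *)
      Jump 2 9; Jump 5 14;
      Print 4; Decr 4; Print 4; Decr 2; Jump 5 7;
      Const 3 0; Incr 1; Jump 0 1; Jump 5 32;
      Decr 4; Jump 4 22;  (* 18: arrow *)
      Jump 3 29; Jump 5 24;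
      Decr 4; Jump 4 29;
      Print 1; Incr 1; Print 1; Const 3 1; Jump 5 1;
      Incr 2; Incr 1; Jump 5 1].


(** An upper bound on the number of steps lets branches of different lengths share one budget. *)
Definition ends (T : nat) (s : config) (Q : config -> Prop) : Prop :=
  exists2 t, t <= T & Q (iter t (step solver) s).

Lemma ends_now (T : nat) (s : config) (Q : config -> Prop) : Q s -> ends T s Q.
Proof. by exists 0. Qed.

Lemma ends_step (T : nat) (s : config) (Q : config -> Prop) :
  ends T (step solver s) Q -> ends T.+1 s Q.
Proof. by case=> t le q; exists t.+1; rewrite ?iterSr. Qed.

Lemma ends_le (T T' : nat) (s : config) (Q : config -> Prop) :
  T <= T' -> ends T s Q -> ends T' s Q.
Proof. by move=> le [t le' q]; exists t => //; apply: leq_trans le. Qed.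

(** Each round of the loop at addresses 7 to 13 prints one left move in six instructions, with the
    position in X4; leaving it takes two. X3 is not tracked, as it is reset at 14. *)
Lemma solver_flush (T q : nat) (X : nat -> nat) (inp out : seq nat)
    (Q : config -> Prop) :
  X 2 = q -> X 5 = 1 ->
  (forall Y, Y 0 = X 0 -> Y 1 = X 1 -> Y 2 = 0 -> Y 5 = 1 ->
     ends T (Config 14 Y inp (out ++ moves_code (left_moves (X 4) q))) Q) ->
  ends (2 + (6 * q + T)) (Config 7 X inp out) Q.
Proof.
elim: q X out => [|q IH] X out X2 X5 H.
  do 2! (apply: ends_step; rewrite /step /upd /= ?X2 ?X5 /=).
  by move: (H X); rewrite cats0; exact.
rewrite mulnS -addnA addnCA.
do 6! (apply: ends_step; rewrite /step /upd /= ?X2 ?X5 /=).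
apply: IH => //= Y Y0 Y1 Y2 Y5.
by rewrite -!cats1 -!catA; apply: H.
Qed.

Lemma moves_code_cat (ms ms' : seq move) :
  moves_code (ms ++ ms') = moves_code ms ++ moves_code ms'.
Proof. by rewrite /moves_code map_cat flatten_cat. Qed.

(** Amortized count: a letter that postpones a left move costs at most 12 instructions and prepays
    the 6 that print it, hence 18; the other letters fit within 18 once their flush is charged to
    [6 * q]. *)
Lemma solver_loop (w : seq letter) (i q : nat) (r : bool) (X : nat -> nat) (out : seq nat) :
  X 1 = i -> X 2 = q -> X 3 = r -> X 5 = 1 ->
  ends (18 * size w + 6 * q + 12) (Config 1 X (word_code w) out)
    (fun s => halted solver s /\ output s = out ++ moves_code (solution i q r w)).
Proof.
elim: w i q r X out => [|[d b] w IH] i q r X out X1 X2 X3 X5.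
  (* The end of the input reads 0 and, by truncated decrements, follows the branch of a bar;
     [X0 = 0] then leads out of the program. *)
  apply: (@ends_le (6 + (2 + (6 * q + 4)))); first by lia.
  do 6! (apply: ends_step; rewrite /step /upd /= ?X2 ?X5 /=).
  apply: solver_flush => //= Y Y0 Y1 Y2 Y5; rewrite /upd /= in Y0 Y1 *;
  do 4! (apply: ends_step; rewrite /step /upd /= ?Y0 ?Y5 /=).
  by apply: ends_now; rewrite X1.
rewrite -[size (_ :: w)]/(size w).+1.
have weak T := @ends_le T (18 * (size w).+1 + 6 * q + 12).
case: d weak => weak.
- apply: (weak (6 + (2 + (6 * q + (3 + (18 * size w + 6 * 0 + 12)))))); first by lia.
  case: b {weak}; do 6! (apply: ends_step; rewrite /step /upd /= ?X1 ?X2 ?X5 /=);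
    apply: solver_flush => //= Y Y0 Y1 Y2 Y5; rewrite /upd /= ?X1 in Y0 Y1;
    do 3! (apply: ends_step; rewrite /step /upd /= ?Y0 ?Y1 ?Y5 /=);
    by rewrite moves_code_cat catA; apply: IH; rewrite //= ?X1.
- case: b.
    case: r X3 => X3.
      apply: (weak (11 + (18 * size w + 6 * q.+1 + 12))); first by lia.
      do 11! (apply: ends_step; rewrite /step /upd /= ?X1 ?X2 ?X3 ?X5 /=).
      by apply: IH; rewrite //= ?X1 ?X2 ?X3.
    apply: (weak (14 + (18 * size w + 6 * q + 12))); first by lia.
    do 14! (apply: ends_step; rewrite /step /upd /= ?X1 ?X2 ?X3 ?X5 /=).
    by rewrite -(cat1s (i, _)) moves_code_cat catA -!cats1 -(catA out [:: i]); apply: IH.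
  apply: (weak (14 + (18 * size w + 6 * q + 12))); first by lia.
  do 14! (apply: ends_step; rewrite /step /upd /= ?X1 ?X2 ?X3 ?X5 /=).
  rewrite andbF -(cat1s (i, _)) moves_code_cat catA -!cats1 -(catA out [:: i]).
  by apply: IH.
apply: (weak (12 + (18 * size w + 6 * q.+1 + 12))); first by lia.
by case: b {weak}; do 12! (apply: ends_step; rewrite /step /upd /= ?X1 ?X2 ?X3 ?X5 /=);
  apply: IH; rewrite //= ?X1 ?X2 ?X3.
Qed.

Lemma halted_iter (P : program) (s : config) (t : nat) :
  halted P s -> iter t (step P) s = s.
Proof. by move=> hs; elim: t => //= t ->; rewrite /step hs. Qed.

Lemma solver_computes (w : seq letter) :
  computes_within solver (word_code w) (moves_code (solution 0 0 false w))
                  (18 * (size w).+1).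
Proof.
have [t le_t [ht ot]] : ends (18 * (size w).+1) (start (word_code w)) (fun s =>
    halted solver s /\ output s = moves_code (solution 0 0 false w)).
  apply: (@ends_le (1 + (18 * size w + 6 * 0 + 12))); first by lia.
  by apply: ends_step; apply: solver_loop.
(* A halted configuration is fixed, so the run extends to exactly the stated time. *)
rewrite /computes_within -(subnK le_t) iterD halted_iter //.
Qed.

Theorem theorem4 :
  (forall (c : seq color) (k : nat), c != [::] ->
     (exists ms : seq move, reduces c ms k) <->
     (exists w : seq letter, certificate c k w))
  /\
  (exists (P : program) (C : nat),
     forall (c : seq color) (k : nat) (w : seq letter),
       c != [::] -> certificate c k w ->
       exists ms : seq move,
         reduces c ms k /\
         computes_within P (word_code w) (moves_code ms) (C * size c)).
Proof.
split=> [[|x c] k // _|].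
  split=> [[ms]|[w cw]]; first exact: reduces_certificate.
  by exists (solution 0 0 false w); apply: certificate_reduces.
exists solver, 18 => -[|x c] k w // _ cw.
exists (solution 0 0 false w); split; first exact: certificate_reduces.
(* [w] has one letter fewer than [c] has pawns, so the bound in [(size w).+1] is linear in
   [size c]. *)
by case: cw => -[/= <- _] _ _; apply: solver_computes.
Qed.
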